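(* Let $m\ge 3$. For the direct product $P_2\times C_m$ of the path $P_2$ of order $2$ and the cycle $C_m$ of order $m$, the harmonic centralization is zero: $C_{\mathcal H}(P_2\times C_m)=0$.
   Context: All graphs are simple, undirected and finite. For a graph $G$ of order $n\ge 2$ (number of vertices) and a vertex $u$, the harmonic centrality of $u$ is $\mathcal{H}_G(u)=\frac{\mathcal{R}_G(u)}{n-1}$, where $\mathcal{R}_G(u)=\sum_{x\in V(G),\,x\ne u}\frac{1}{d(u,x)}$, $d$ is the shortest-path distance in $G$, and $\frac{1}{d(u,x)}=0$ if there is no path from $u$ to $x$. For a graph $G$ of order $n\ge 3$, the harmonic centralization is $$C_{\mathcal H}(G)=\frac{\sum_{x\in V(G)}\big(\mathcal{H}_{G,\max}-\mathcal{H}_G(x)\big)}{\frac{n-2}{2}},\qquad \mathcal{H}_{G,\max}=\max_{x\in V(G)}\mathcal{H}_G(x).$$ The direct product $G\times H$ has vertex set $V(G)\times V(H)$, with $(u,v)$ and $(u',v')$ adjacent iff $u,u'$ are adjacent in $G$ and $v,v'$ are adjacent in $H$. *)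

(* Defs.v *)
From mathcomp Require Import all_boot all_order all_algebra.
Set Implicit Arguments.
Unset Strict Implicit.
Unset Printing Implicit Defensive.
Import Order.TTheory GRing.Theory Num.Theory.

Record sgraph := SGraph {
  vertex :> finType;
  adj : rel vertex;
  adj_sym : symmetric adj;
  adj_irrefl : irreflexive adj }.

Definition walk (G : sgraph) (k : nat) (x y : G) : bool :=
  [exists p : k.-tuple G, path (@adj G) x p && (last x p == y)].

(* A shortest walk repeats no vertex, so lengths below #|G| suffice (dist_walk,
   dist_min); when no walk joins x to y, dist x y takes the junk value #|G|. *)
Definition dist (G : sgraph) (x y : G) : nat :=
  find (fun k => walk k x y) (iota 0 #|G|).

Lemma walkP (G : sgraph) k (x y : G) :
  reflect (exists p : seq G, [/\ size p = k, path (@adj G) x p & last x p = y])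
          (walk k x y).
Proof.
apply: (iffP existsP) => [[p /andP[pp /eqP lp]]|[p [sp pp lp]]].
  by exists p; rewrite size_tuple.
have sp' : size p == k by apply/eqP.
by exists (Tuple sp'); rewrite /= pp lp eqxx.
Qed.

Lemma walk_short (G : sgraph) (x y : G) :
  connect (@adj G) x y -> exists2 k, k < #|G| & walk k x y.
Proof.
case/connectP=> p pp ->; case/shortenP: pp => q pq uq _.
exists (size q); last by apply/walkP; exists q.
by rewrite -[(size q).+1]/(size (x :: q)) -(card_uniqP uq) max_card.
Qed.

Lemma dist_walk (G : sgraph) (x y : G) :
  connect (@adj G) x y -> walk (dist x y) x y.
Proof.
case/walk_short=> k kG wk.
have hw : has (fun k => walk k x y) (iota 0 #|G|).
  by apply/hasP; exists k; rewrite // mem_iota.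
have := nth_find 0 hw; rewrite -/(dist x y) nth_iota //.
by move: hw; rewrite has_find size_iota.
Qed.

Lemma dist_min (G : sgraph) (x y : G) k : walk k x y -> dist x y <= k.
Proof.
move=> wk; rewrite leqNgt; apply/negP => kd.
have kG : k < #|G|.
  by apply: leq_trans kd _; rewrite -(size_iota 0 #|G|) find_size.
by have := before_find 0 kd; rewrite nth_iota // wk.
Qed.

Definition path_adj n (i j : 'I_n) : bool := (i.+1 == j) || (j.+1 == i).

Lemma path_adj_sym n : symmetric (@path_adj n).
Proof. by move=> i j; rewrite /path_adj orbC. Qed.

Lemma path_adj_irrefl n : irreflexive (@path_adj n).
Proof. by move=> i; rewrite /path_adj orbb gtn_eqF. Qed.

Definition path_graph (n : nat) : sgraph :=
  SGraph (@path_adj_sym n) (@path_adj_irrefl n).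

(* The conjunct i != j matters only for n = 1, where it removes a loop. *)
Definition cycle_adj n (i j : 'I_n) : bool :=
  (i != j) && ((i.+1 %% n == j) || (j.+1 %% n == i)).

Lemma cycle_adj_sym n : symmetric (@cycle_adj n).
Proof. by move=> i j; rewrite /cycle_adj eq_sym orbC. Qed.

Lemma cycle_adj_irrefl n : irreflexive (@cycle_adj n).
Proof. by move=> i; rewrite /cycle_adj eqxx. Qed.

Definition cycle_graph (n : nat) : sgraph :=
  SGraph (@cycle_adj_sym n) (@cycle_adj_irrefl n).

Definition direct_adj (G H : sgraph) (u v : G * H) : bool :=
  adj u.1 v.1 && adj u.2 v.2.

Lemma direct_adj_sym (G H : sgraph) : symmetric (@direct_adj G H).
Proof.
by move=> u v; rewrite /direct_adj (adj_sym u.1 v.1) (adj_sym u.2 v.2).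
Qed.

Lemma direct_adj_irrefl (G H : sgraph) : irreflexive (@direct_adj G H).
Proof. by move=> u; rewrite /direct_adj adj_irrefl. Qed.

Definition direct_product (G H : sgraph) : sgraph :=
  SGraph (@direct_adj_sym G H) (@direct_adj_irrefl G H).

Local Open Scope ring_scope.

Definition inv_dist (G : sgraph) (u x : G) : rat :=
  if connect (@adj G) u x then ((dist u x)%:R)^-1 else 0.

Definition reciprocal_sum (G : sgraph) (u : G) : rat :=
  \sum_(x : G | x != u) inv_dist u x.

Definition harmonic_centrality (G : sgraph) (u : G) : rat :=
  reciprocal_sum u / (#|G|%:R - 1).

(* Harmonic centralities are nonnegative when 2 <= #|G|, so starting the
   iterated maximum at 0 does not change its value. *)
Definition max_harmonic_centrality (G : sgraph) : rat :=
  \big[Num.max/0]_(x : G) harmonic_centrality x.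

Definition harmonic_centralization (G : sgraph) : rat :=
  (\sum_(x : G) (max_harmonic_centrality G - harmonic_centrality x))
    / ((#|G|%:R - 2%:R) / 2%:R).

(* Main.v *)
(* Both factors are vertex-transitive, hence so is their direct product.
   Automorphisms preserve distances, so every vertex has the same harmonic
   centrality, which is therefore the maximum, and every summand of the
   centralization vanishes. *)
Require Import Defs.
From mathcomp Require Import all_boot all_order all_algebra.
Import Order.TTheory GRing.Theory Num.Theory.
Local Open Scope ring_scope.

Definition automorphism (G : sgraph) (f : G -> G) : Prop :=
  injective f /\ {mono f : x y / adj x y}.

Definition vertex_transitive (G : sgraph) : Prop :=
  forall x y : G, exists2 f : G -> G, automorphism G f & f x = y.

(** Reduces reachability to walks, so that invariance of [walk] settles both branches of
    [inv_dist]. *)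
Lemma walk_connect (G : sgraph) (x y : G) :
  reflect (exists k, walk k x y) (connect (@adj G) x y).
Proof.
apply: (iffP idP) => [/walk_short[k _ wk]|[k /walkP[p [_ pp lp]]]].
  by exists k.
by apply/connectP; exists p.
Qed.

(** Mapping a walk through [f] gives a walk of the same length. Conversely, an injective self-map of
    a finite set is invertible, so walks between images pull back. *)
Lemma automorphism_walk (G : sgraph) (f : G -> G) k x y :
  automorphism G f -> walk k (f x) (f y) = walk k x y.
Proof.
move=> [injf adjf].
have pathf z q : path (@adj G) (f z) (map f q) = path (@adj G) z q.
  by rewrite path_map; apply: eq_path => a b; apply: adjf.
apply/walkP/walkP => -[p [sp pp lp]].
  have Ep : p = map f (map (invF injf) p).
    by rewrite mapK //; apply: f_invF.
  exists (map (invF injf) p); split; first by rewrite size_map.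
    by rewrite -pathf -Ep.
  by apply: (injf); rewrite -last_map -Ep.
by exists (map f p); rewrite size_map pathf last_map lp.
Qed.

Lemma automorphism_inv_dist (G : sgraph) (f : G -> G) x y :
  automorphism G f -> inv_dist (f x) (f y) = inv_dist x y.
Proof.
move=> autf; rewrite /inv_dist.
have -> : connect (@adj G) (f x) (f y) = connect (@adj G) x y.
  by apply/walk_connect/walk_connect => -[k wk]; exists k;
    rewrite automorphism_walk in wk *.
have -> // : dist (f x) (f y) = dist x y.
by apply: eq_find => k; apply: automorphism_walk.
Qed.

Lemma automorphism_harmonic_centrality (G : sgraph) (f : G -> G) x :
  automorphism G f -> harmonic_centrality (f x) = harmonic_centrality x.
Proof.
move=> autf; have [injf _] := autf.
(* Summing over [f y] instead of [y] turns the exclusion of [f x] into that of [x]. *)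
rewrite /harmonic_centrality /reciprocal_sum (reindex_inj injf) /=.
congr (_ / _); apply: eq_big => [y|y _]; first by rewrite (inj_eq injf).
exact: automorphism_inv_dist.
Qed.

Lemma harmonic_centrality_ge0 (G : sgraph) (x : G) : 0 <= harmonic_centrality x.
Proof.
apply: divr_ge0.
  by apply: sumr_ge0 => y _; rewrite /inv_dist; case: ifP; rewrite // invr_ge0 ler0n.
by rewrite subr_ge0 ler1n; apply/card_gt0P; exists x.
Qed.

Lemma vertex_transitive_harmonic_centralization (G : sgraph) :
  vertex_transitive G -> harmonic_centralization G = 0.
Proof.
move=> trG; rewrite /harmonic_centralization big1 ?mul0r // => x _.
apply/eqP; rewrite subr_eq0 eq_le; apply/andP; split; last exact: le_bigmax.
(* The iterated maximum starts at 0, so bounding it also requires 0 to lie below the centrality of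
   [x]. *)
apply: bigmax_le => [|y _]; first exact: harmonic_centrality_ge0.
by have [f autf <-] := trG x y; rewrite automorphism_harmonic_centrality.
Qed.

Lemma direct_product_vertex_transitive (G H : sgraph) :
  vertex_transitive G -> vertex_transitive H ->
  vertex_transitive (direct_product G H).
Proof.
move=> trG trH [x1 x2] [y1 y2].
have [f [injf adjf] <-] := trG x1 y1; have [g [injg adjg] <-] := trH x2 y2.
exists (fun u : G * H => (f u.1, g u.2)) => //; split.
  by move=> [a b] [c d] /= [] /injf -> /injg ->.
by move=> u v; rewrite /= /direct_adj /= adjf adjg.
Qed.

Lemma path2_vertex_transitive : vertex_transitive (path_graph 2).
Proof.
move=> x y; have [->|neq_xy] := eqVneq x y; first by exists id => //; split.
(* Distinct [x] and [y] are the two ends of the path, which reversal swaps. *)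
exists (@rev_ord 2).
  split; first exact: rev_ord_inj.
  by do 2!case=> [[|[|//]] ?].
apply: val_inj; move: neq_xy; rewrite -val_eqE.
by case: x y => [[|[|//]] ?] [[|[|//]] ?].
Qed.

Lemma val_iter_ordS n k (i : 'I_n) : val (iter k (@ordS n) i) = ((i + k) %% n)%N.
Proof.
elim: k => [|k IHk]; first by rewrite addn0 modn_small.
by rewrite iterS /= IHk -addn1 modnDml addn1 addnS.
Qed.

(** Rotations, the iterates of the cyclic successor [ordS], carry any vertex to any other. *)
Lemma cycle_vertex_transitive n : vertex_transitive (cycle_graph n).
Proof.
(* Rotating by [n - x + y] sends [x] to [n + y], that is [y] modulo [n]; adding [n] avoids truncated
   subtraction when [y < x]. *)
move=> x y; exists (iter (n - x + y) (@ordS n)); last first.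
  apply: val_inj; rewrite val_iter_ordS addnA subnKC; last exact: ltnW.
  by rewrite modnDl modn_small.
elim: (n - x + y)%N => [|k [injk adjk]]; first by split.
split=> [a b /ordS_inj /injk //|a b].
rewrite iterS -[RHS]adjk; set u := iter k _ a; set v := iter k _ b.
(* Written with [ordS], adjacency consists of equality tests only, and injectivity of [ordS] cancels
   one successor in each. *)
have adjE (i j : 'I_n) : cycle_adj i j = (i != j) && ((ordS i == j) || (ordS j == i)).
  by [].
by rewrite /= !adjE !(inj_eq (@ordS_inj n)).
Qed.

Theorem theorem3p11 (m : nat) (hm : (3 <= m)%N) :
  harmonic_centralization (direct_product (path_graph 2) (cycle_graph m)) = 0.
Proof.
apply: vertex_transitive_harmonic_centralization.
apply: direct_product_vertex_transitive.
  exact: path2_vertex_transitive.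
exact: cycle_vertex_transitive.
Qed.
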